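(* Let $G$ be a finite simple graph on $n$ vertices with maximum degree $\Delta \ge 1$, and let $\lambda_{2}$ be the second smallest Laplacian eigenvalue of $G$. Then \[ \mathrm{tw}(G) \ge \frac{n \lambda_{2}}{\Delta + \lambda_{2}} - 1, \] where $\mathrm{tw}(G)$ is the treewidth of $G$.
   Context: For a graph $G=(V,E)$ with $n$ vertices, the Laplacian matrix $L \in \mathbb{Z}^{V\times V}$ is given by $L(u,u)=\deg(u)$, $L(u,v)=-1$ if $\{u,v\}\in E$, and $L(u,v)=0$ otherwise (for $u \ne v$). The Laplacian eigenvalues are the eigenvalues of $L$, listed in non-decreasing order as $\lambda_1 \le \lambda_2 \le \dots \le \lambda_n$. Treewidth is the standard notion: the minimum, over all tree decompositions of $G$, of the maximum bag size minus one. *)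

(* Defs.v *)
From mathcomp Require Import all_boot all_order all_algebra.
From mathcomp Require Import boolp.
Set Implicit Arguments. Unset Strict Implicit. Unset Printing Implicit Defensive.
Import Order.TTheory GRing.Theory Num.Theory.
Local Open Scope ring_scope.

Definition simple_graph (n : nat) (e : rel 'I_n) : Prop :=
  symmetric e /\ irreflexive e.

Definition deg (n : nat) (e : rel 'I_n) (v : 'I_n) : nat := #|[set u | e v u]|.

Definition max_degree (n : nat) (e : rel 'I_n) : nat := \max_(v : 'I_n) deg e v.

Definition laplacian (R : nzRingType) (n : nat) (e : rel 'I_n) : 'M[R]_n :=
  \matrix_(i, j) (if i == j then (deg e i)%:R
                  else if e i j then -1 else 0).

Definition is_sorted_spectrum (R : realFieldType) (n : nat) (A : 'M[R]_n)
    (s : seq R) : Prop :=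
  sorted <=%R s /\ char_poly A = \prod_(x <- s) ('X - x%:P).

Definition is_tree (m : nat) (t : rel 'I_m.+1) : Prop :=
  [/\ symmetric t, irreflexive t,
      (forall i j, connect t i j) &
      #|[set p : 'I_m.+1 * 'I_m.+1 | t p.1 p.2]| = (2 * m)%N].

Definition is_tree_decomposition (n : nat) (e : rel 'I_n) (m : nat)
    (t : rel 'I_m.+1) (B : 'I_m.+1 -> {set 'I_n}) : Prop :=
  [/\ is_tree t,
      (forall v : 'I_n, exists i, v \in B i),
      (forall u v : 'I_n, e u v -> exists i, (u \in B i) && (v \in B i)) &
      (forall (v : 'I_n) (i j : 'I_m.+1), v \in B i -> v \in B j ->
         connect [rel a b | [&& t a b, v \in B a & v \in B b]] i j)].

Definition td_width (n m : nat) (B : 'I_m.+1 -> {set 'I_n}) : nat :=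
  (\max_(i : 'I_m.+1) #|B i|).-1.

Definition has_td_of_width (n : nat) (e : rel 'I_n) (k : nat) : Prop :=
  exists m (t : rel 'I_m.+1) (B : 'I_m.+1 -> {set 'I_n}),
    is_tree_decomposition e t B /\ td_width B = k.

Lemma has_td_exists (n : nat) (e : rel 'I_n) :
  exists k, `[< has_td_of_width e k >].
Proof.
exists (td_width (fun _ : 'I_1 => [set: 'I_n])).
apply/asboolP; exists 0%N, (fun _ _ => false), (fun _ => [set: 'I_n]).
split=> //; split.
- split=> //.
    by move=> i j; rewrite !ord1 connect0.
  by apply/eqP; rewrite cards_eq0; apply/eqP/setP => p; rewrite !inE.
- by move=> v; exists ord0; rewrite inE.
- by move=> u v _; exists ord0; rewrite !inE.
- by move=> v i j _ _; rewrite !ord1 connect0.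
Qed.

Definition treewidth (n : nat) (e : rel 'I_n) : nat :=
  ex_minn (has_td_exists e).

(* Main.v *)
(** A bag [S] of a tree decomposition, or a set squeezed between two adjacent
bags, splits the remaining [N] vertices into mutually non-adjacent classes of
size at most [N / 2].  Cutting at a median class merges them into three classes
satisfying the triangle inequality, so there are unit vectors of the plane,
one per class, whose sum weighted by the class sizes vanishes.  Mapping each
class to its vector and [S] to the origin, both coordinates are orthogonal to
the constants; adding up their quadratic forms, only the edges between [S] and
its complement contribute, each of them 1.  Hence [lambda_2 * N <= Delta * #|S|],
which is the claim. *)
Require Import Defs.
From mathcomp Require Import all_boot all_order all_algebra.
From mathcomp Require Import boolp complex ring lra zify.
Set Implicit Arguments. Unset Strict Implicit. Unset Printing Implicit Defensive.
Import Order.TTheory GRing.Theory Num.Theory.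
Local Open Scope ring_scope.

(** * Rayleigh bounds for the second smallest eigenvalue *)

Lemma char_poly_conj_diag (F : fieldType) n (P : 'M[F]_n) (d : 'rV[F]_n) :
  P \in unitmx ->
  char_poly (invmx P *m diag_mx d *m P) = \prod_(x <- codom (d 0)) ('X - x%:P).
Proof.
move=> uP; rewrite /char_poly /char_poly_mx.
have uP' : map_mx polyC P \in unitmx by rewrite map_unitmx.
have -> : 'X%:M - map_mx polyC (invmx P *m diag_mx d *m P) =
   invmx (map_mx polyC P) *m ('X%:M - map_mx polyC (diag_mx d)) *m map_mx polyC P.
  rewrite mulmxBr mulmxBl !map_mxM/= map_invmx; congr (_ - _).
  by rewrite scalar_mxC -mulmxA mulVmx // mulmx1.
rewrite !det_mulmx mulrAC -det_mulmx mulVmx // det1 mul1r.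
have -> : 'X%:M - map_mx polyC (diag_mx d) = diag_mx (\row_j ('X - (d 0 j)%:P)).
  apply/matrixP=> i j; rewrite !mxE; case: eqVneq => _ //=.
  by rewrite polyC0 subr0.
by rewrite det_diag big_map big_enum; apply: eq_bigr => i _; rewrite mxE.
Qed.

Local Open Scope sesquilinear_scope.

(** In a unitary eigenbasis at most one diagonal entry lies below [l], and the kernel vector [u]
    exhibits one, namely 0 at an index [i0]. So [u] is supported on [i0] alone, [v] has no [i0]
    coordinate, and [v] only meets entries at least [l]. *)
Lemma hermitian_rayleigh_ge (C : numClosedFieldType) n (A : 'M[C]_n)
    (s : seq C) (l : C) (u v : 'rV[C]_n) :
  A \is hermsymmx -> char_poly A = \prod_(x <- s) ('X - x%:P) ->
  0 < l -> all (>= l) (behead s) ->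
  u *m A = 0 -> u != 0 -> v *m u ^t* = 0 ->
  l * (v *m v ^t*) 0 0 <= (v *m A *m v ^t*) 0 0.
Proof.
move=> Aherm chA l_gt0 s_ge uA u_neq0 vu.
have /orthomx_spectralP A_eq := hermitian_normalmx Aherm.
set P := spectralmx A in A_eq *; set d := spectral_diag A in A_eq *.
have Pu : P \is unitarymx by exact: spectral_unitarymx.
have Punit : P \in unitmx by exact: spectral_unit.
(* Both lists are the roots, with multiplicity, of the same split polynomial. *)
have perm_d : perm_eq s (codom (d 0)).
  by apply: prod_XsubC_eq; rewrite -chA {1}A_eq char_poly_conj_diag.
have card_small : (#|[set i | ~~ (l <= d 0 i)%R]| <= 1)%N.
  have -> : #|[set i | ~~ (l <= d 0 i)%R]| = count (fun x => ~~ (l <= x)) s.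
    rewrite (permP perm_d) /codom count_map -sum1_card -sum1_count big_enum_cond.
    by apply: eq_bigl => i; rewrite !inE.
  case: s s_ge {chA perm_d} => //= x s /allP s_ge.
  suff -> : count (fun x => ~~ (l <= x)) s = 0%N by case: (l <= x).
  by apply/eqP; rewrite -leqn0 leqNgt -has_count; apply/hasPn => y /s_ge ->.
rewrite invmx_unitary // in A_eq.
have PtP : P ^t* *m P = 1%:M by rewrite -invmx_unitary // mulVmx.
set u' := u *m P ^t*; set w := v *m P ^t*.
have wE (x y : 'rV[C]_n) : x *m y ^t* = (x *m P ^t*) *m (y *m P ^t*) ^t*.
  by rewrite trmx_mul map_mxM /= trmxCK !mulmxA -(mulmxA x) PtP mulmx1.
have u'd i : u' 0 i * d 0 i = 0.
  have : u' *m diag_mx d = 0.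
    have := congr1 (fun M => M *m P ^t*) uA; rewrite /= mul0mx A_eq.
    by rewrite !mulmxA mulmxtVK.
  by rewrite mul_mx_diag => /rowP /(_ i); rewrite !mxE.
have [i0 u'i0] : exists i0, u' 0 i0 != 0.
  apply/existsP; rewrite -[[exists _, _]]negbK negb_exists; apply: contra u_neq0.
  move=> /forallP u'0; have {}u'0 : u' = 0.
    by apply/rowP => i; rewrite [RHS]mxE; apply/eqP; move: (u'0 i); rewrite negbK.
  by rewrite -[u]mulmx1 -PtP mulmxA -/u' u'0 mul0mx.
have di0 : i0 \in [set i | ~~ (l <= d 0 i)].
  have /eqP := u'd i0; rewrite mulf_eq0 (negPf u'i0) /= inE => /eqP ->.
  by rewrite lt_geF.
have d_ge i : i != i0 -> l <= d 0 i.
  move=> ii0; apply: contraTT card_small => nle; rewrite -ltnNge.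
  rewrite (cardsD1 i0) di0 (cardsD1 i) !inE ii0 nle //.
have dotE (x y : 'rV[C]_n) : (x *m y ^t*) 0 0 = \sum_i x 0 i * (y 0 i)^*.
  by rewrite mxE; apply: eq_bigr => i _; rewrite !mxE.
have wi0 : w 0 i0 = 0.
  move: vu; rewrite wE -/u' -/w => /matrixP /(_ 0 0); rewrite dotE [RHS]mxE.
  rewrite (bigD1 i0) //= big1 ?addr0 => [|i ii0].
    by move/eqP; rewrite mulf_eq0 conjC_eq0 (negPf u'i0) orbF => /eqP.
  have /eqP := u'd i; rewrite mulf_eq0 orbC gt_eqF ?(lt_le_trans l_gt0 (d_ge _ _)) //=.
  by move=> /eqP ->; rewrite conjC0 mulr0.
rewrite {1}A_eq wE -/w.
have -> : v *m (P ^t* *m diag_mx d *m P) *m v ^t* = w *m diag_mx d *m w ^t*.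
  by rewrite /w trmx_mul map_mxM /= trmxCK !mulmxA.
rewrite mul_mx_diag !dotE mulr_sumr ler_sum // => i _; rewrite [X in _ <= X * _]mxE.
have [->|ii0] := eqVneq i i0; first by rewrite wi0 !mul0r mulr0.
by rewrite mulrAC mulrC ler_wpM2l ?mul_conjC_ge0 ?d_ge.
Qed.

Local Close Scope sesquilinear_scope.

(** Follows from the Hermitian case over the algebraically closed field [complex R]: conjugation
    fixes real entries, and the embedding of [R] preserves the order. *)
Lemma symmetric_rayleigh_ge (R : rcfType) n (A : 'M[R]_n) (s : seq R) (u v : 'rV[R]_n) :
  A^T = A -> is_sorted_spectrum A s -> 0 < s`_1 ->
  u *m A = 0 -> u != 0 -> v *m u^T = 0 ->
  s`_1 * (v *m v^T) 0 0 <= (v *m A *m v^T) 0 0.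
Proof.
move=> Asym [s_sorted chA] s1_gt0 uA u_neq0 vu.
pose toC : R -> complex R := real_complex R.
have toC_conj m (x : 'rV[R]_m) : ((map_mx toC x) ^t*)%sesqui = map_mx toC x^T.
  apply/matrixP => i j; rewrite !mxE; apply: conj_Creal.
  by apply/complex_realP; exists (x j i).
rewrite -lecR rmorphM /=.
have toC00 (M : 'M[R]_1) : (M 0 0)%:C%C = (map_mx toC M) 0 0 by rewrite mxE.
rewrite !toC00 !map_mxM -!toC_conj.
apply: (@hermitian_rayleigh_ge _ _ _ (map toC s) _ (map_mx toC u)).
- apply/is_hermitianmxP; rewrite expr0 scale1r; apply/matrixP => i j; rewrite !mxE.
  rewrite conj_Creal; first by rewrite -{1}Asym mxE.
  by apply/complex_realP; exists (A j i).
- by rewrite -map_char_poly chA map_prod_XsubC big_map.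
- by rewrite (_ : 0 = toC 0) // ltcR.
- case: s s_sorted s1_gt0 {chA} => //= x [|y s] //= /andP[_ ys] _.
  rewrite lexx /=; apply/allP => _ /mapP[z z_s ->]; rewrite lecR.
  by have /allP/(_ z z_s) := order_path_min le_trans ys.
- by rewrite -map_mxM uA map_mx0.
- by rewrite map_mx_eq0.
- by rewrite toC_conj -map_mxM vu map_mx0.
Qed.

(** * The Laplacian and its quadratic form *)

Lemma laplacian_quadratic_form (R : rcfType) n (e : rel 'I_n) (v : 'rV[R]_n) :
  simple_graph e ->
  (v *m laplacian R e *m v^T) 0 0 *+ 2 =
  \sum_i \sum_(j | e i j) (v 0 i - v 0 j) ^+ 2.
Proof.
move=> [e_sym e_irr].
have -> : (v *m laplacian R e *m v^T) 0 0 =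
    \sum_i \sum_(j | e i j) (v 0 i ^+ 2 - v 0 i * v 0 j).
  rewrite -mulmxA mxE; apply: eq_bigr => i _; rewrite !mxE.
  rewrite sumrB sumr_const -mulr_sumr (bigD1 i) //= !mxE eqxx mulrDr.
  congr (_ + _); first by rewrite /deg cardsE -[RHS]mulr_natl expr2 mulrCA.
  rewrite -mulrN; congr (_ * _); rewrite (big_mkcond (e i)) -sumrN big_mkcond /=; apply: eq_bigr => j _.
  rewrite !mxE eq_sym; case: eqVneq => [->|_] /=; first by rewrite e_irr oppr0.
  by case: (e i j); rewrite ?mulN1r // mul0r oppr0.
rewrite mulr2n.
(* The sums run over ordered pairs, so each edge counts twice. Swapping the two ends in one of the
   two copies supplies the missing square. *)
have {2}-> : \sum_i \sum_(j | e i j) (v 0 i ^+ 2 - v 0 i * v 0 j) =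
    \sum_i \sum_(j | e i j) (v 0 j ^+ 2 - v 0 i * v 0 j).
  rewrite (exchange_big_dep xpredT) //=; apply: eq_bigr => i _.
  by apply: eq_big => [j|j _]; rewrite 1?e_sym 1?[v 0 j * _]mulrC.
rewrite -big_split; apply: eq_bigr => i _; rewrite -big_split.
by apply: eq_bigr => j _ /=; ring.
Qed.

Lemma laplacian_sym (R : rcfType) n (e : rel 'I_n) :
  symmetric e -> (laplacian R e)^T = laplacian R e.
Proof.
move=> e_sym; apply/matrixP => i j; rewrite !mxE eq_sym e_sym.
by case: eqVneq => // ->.
Qed.

Lemma laplacian_ones (R : rcfType) n (e : rel 'I_n) :
  simple_graph e -> (const_mx 1 : 'rV_n) *m laplacian R e = 0.
Proof.
move=> [e_sym e_irr]; apply/rowP => j; rewrite !mxE (bigD1 j) //= !mxE eqxx mul1r.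
rewrite (eq_bigr (fun i => - (e j i)%:R)) => [|i ij]; last first.
  by rewrite !mxE mul1r (negPf ij) e_sym; case: (e j i); rewrite ?oppr0.
rewrite sumrN -natr_sum /deg -sum1_card big_mkcond (bigD1 j) //= !inE e_irr add0n.
by rewrite (eq_bigr (fun i => e j i : nat)) ?subrr // => i _; rewrite inE; case: (e j i).
Qed.

(** At an eigenvector the quadratic form, a sum of squares, is the eigenvalue times a positive
    squared norm. Beyond the end of [s] the default value is 0. *)
Lemma fiedler_ge0 (R : rcfType) n (e : rel 'I_n) (s : seq R) (i : nat) :
  simple_graph e -> is_sorted_spectrum (laplacian R e) s -> 0 <= s`_i.
Proof.
move=> eG [_ chL]; have [s_i|] := boolP (i < size s)%N; last first.
  by rewrite -leqNgt => /(nth_default 0) ->.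
have : root (char_poly (laplacian R e)) s`_i by rewrite chL root_prod_XsubC mem_nth.
rewrite -eigenvalue_root_char => /eigenvalueP[v vL v_neq0].
have vv_gt0 : 0 < (v *m v^T) 0 0.
  rewrite lt_def; apply/andP; split; last first.
    by rewrite mxE sumr_ge0 // => j _; rewrite mxE -expr2 sqr_ge0.
  apply: contra v_neq0; rewrite mxE psumr_eq0 => [/allP v0|j _]; last first.
    by rewrite mxE -expr2 sqr_ge0.
  apply/eqP/rowP => j; have := v0 j (mem_index_enum j).
  by rewrite !mxE -expr2 sqrf_eq0 => /eqP.
rewrite -(pmulr_lge0 _ vv_gt0) -(pmulrn_lge0 _ (ltn0Sn 1)).
have := laplacian_quadratic_form v eG; rewrite vL -scalemxAl mxE => ->.
by rewrite !sumr_ge0 // => j _; rewrite sumr_ge0 // => k _; rewrite sqr_ge0.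
Qed.

Lemma fiedler_rayleigh (R : rcfType) n (e : rel 'I_n) (s : seq R) (x : 'I_n -> R) :
  simple_graph e -> is_sorted_spectrum (laplacian R e) s -> \sum_i x i = 0 ->
  (s`_1 * \sum_i x i ^+ 2) *+ 2 <= \sum_i \sum_(j | e i j) (x i - x j) ^+ 2.
Proof.
move=> eG specL x0.
have := fiedler_ge0 1 eG specL; rewrite le_eqVlt => /orP[/eqP <-|s1_gt0].
  by rewrite mul0r mul0rn !sumr_ge0 // => i _; rewrite sumr_ge0 // => j _; rewrite sqr_ge0.
have n_gt0 : (0 < n)%N.
  case: n e eG specL {x x0} => // e _ [_ chL].
  have := size_char_poly (laplacian R e); rewrite chL size_prod_XsubC => -[s0].
  by rewrite (size0nil s0) ltxx in s1_gt0.
pose v : 'rV[R]_n := \row_i x i.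
have -> : \sum_i x i ^+ 2 = (v *m v^T) 0 0.
  by rewrite mxE; apply: eq_bigr => i _; rewrite !mxE expr2.
rewrite (_ : \sum_i _ = (v *m laplacian R e *m v^T) 0 0 *+ 2).
  rewrite lerMn2r /=; apply: (symmetric_rayleigh_ge (u := const_mx 1)) => //.
  - by apply: laplacian_sym; case: eG.
  - exact: laplacian_ones.
  - apply/eqP => /rowP /(_ (Ordinal n_gt0)); rewrite !mxE; apply/eqP.
    exact: oner_neq0.
  - apply/matrixP => i j; rewrite !mxE -[RHS]x0; apply: eq_bigr => k _.
    by rewrite !mxE mulr1.
rewrite laplacian_quadratic_form //.
by apply: eq_bigr => i _; apply: eq_bigr => j _; rewrite !mxE.
Qed.

(** * From a balanced separator to an eigenvalue inequality *)

Lemma separator_ge_of_plane_embedding (R : rcfType) n (e : rel 'I_n) (s : seq R)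
    (S : {set 'I_n}) (x y : 'I_n -> R) :
  simple_graph e -> is_sorted_spectrum (laplacian R e) s ->
  \sum_v x v = 0 -> \sum_v y v = 0 ->
  (forall v, x v ^+ 2 + y v ^+ 2 = (v \notin S)%:R) ->
  (forall u v, e u v -> u \notin S -> v \notin S -> x u = x v /\ y u = y v) ->
  s`_1 * #|~: S|%:R <= (max_degree e)%:R * #|S|%:R.
Proof.
move=> eG specL x0 y0 xy1 xye.
have := lerD (fiedler_rayleigh eG specL x0) (fiedler_rayleigh eG specL y0).
rewrite -mulrnDl -mulrDr -!big_split /= (eq_bigr _ (fun v _ => xy1 v)).
have -> : \sum_v (v \notin S)%:R = #|~: S|%:R :> R.
  rewrite -natr_sum -sum1_card [in RHS]big_mkcond /=; congr (_%:R).
  by apply: eq_bigr => v _; rewrite inE; case: (v \in S).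
move=> le1; rewrite -(@ler_pMn2r _ 2) //; apply: le_trans le1 _.
(* An edge contributes 0 if both ends lie outside [S], where they share a point, 1 if exactly one
   end is in [S], and 0 again if both are. *)
have edge_le u v : e u v ->
    (x u - x v) ^+ 2 + (y u - y v) ^+ 2 <= ((u \in S) + (v \in S))%:R.
  move=> uv; have := xye _ _ uv; have := xy1 u; have := xy1 v.
  have zero (t : 'I_n) : x t ^+ 2 + y t ^+ 2 = 0 -> x t = 0 /\ y t = 0.
    by move/eqP; rewrite paddr_eq0 ?sqr_ge0 // !sqrf_eq0 => /andP[/eqP -> /eqP ->].
  case: (boolP (u \in S)) => _; case: (boolP (v \in S)) => _ /=.
  - by move=> /zero[-> ->] /zero[-> ->] _; rewrite !subr0 !expr0n /= addr0 ler0n.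
  - by move=> vE /zero[-> ->] _; rewrite !sub0r !sqrrN vE.
  - by move=> /zero[-> ->] uE _; rewrite !subr0 uE.
  - by move=> _ _ /(_ isT isT)[-> ->]; rewrite !subrr !expr0n /= addr0.
have degS : (\sum_u \sum_(v | e u v) (u \in S) <= max_degree e * #|S|)%N.
  rewrite mulnC -sum_nat_const [leqRHS]big_mkcond /=; apply: leq_sum => u _.
  rewrite sum_nat_const -cardsE; case: (u \in S); rewrite ?muln0 // muln1.
  exact: (@leq_bigmax _ (deg e)).
have degS' : (\sum_u \sum_(v | e u v) (v \in S) <= max_degree e * #|S|)%N.
  apply: leq_trans degS; rewrite (exchange_big_dep xpredT) //=.
  by apply: leq_sum => u _; rewrite (eq_bigl (e u)) // => v; case: eG.
apply: (@le_trans _ _ (\sum_u \sum_(v | e u v) ((u \in S) + (v \in S)))%:R).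
  rewrite natr_sum; apply: ler_sum => u _; rewrite -big_split natr_sum /=.
  by apply: ler_sum => v; apply: edge_le.
rewrite -natrM -mulrnA ler_nat muln2 -addnn.
under eq_bigr do rewrite big_split /=.
by rewrite big_split /= leq_add.
Qed.

(** The weights are the side lengths of a possibly degenerate triangle. Its sides, oriented
    cyclically, sum to zero, and the unit vectors are their directions. *)
Lemma unit_triangle (R : rcfType) (a b c : R) :
  0 <= a -> 0 <= b -> 0 <= c -> a <= b + c -> b <= a + c -> c <= a + b ->
  exists z1 z2 z3 : R * R,
    [/\ [/\ z1.1 ^+ 2 + z1.2 ^+ 2 = 1, z2.1 ^+ 2 + z2.2 ^+ 2 = 1
          & z3.1 ^+ 2 + z3.2 ^+ 2 = 1],
        a * z1.1 + b * z2.1 + c * z3.1 = 0 & a * z1.2 + b * z2.2 + c * z3.2 = 0].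
Proof.
move=> a0 b0 c0 abc bac cab.
(* A zero weight forces the other two to be equal, so opposite directions cancel. *)
have [aE|a_neq0] := eqVneq a 0.
  exists (1, 0), (1, 0), (-1, 0); split => /=; [by split; ring| |by ring].
  by rewrite (_ : b = c) ?aE; [ring | lra].
have [bE|b_neq0] := eqVneq b 0.
  exists (1, 0), (1, 0), (-1, 0); split => /=; [by split; ring| |by ring].
  by rewrite (_ : a = c) ?bE; [ring | lra].
have [cE|c_neq0] := eqVneq c 0.
  exists (1, 0), (-1, 0), (1, 0); split => /=; [by split; ring| |by ring].
  by rewrite (_ : a = b) ?cE; [ring | lra].
have a_gt0 : 0 < a by rewrite lt_def a_neq0.
have b_gt0 : 0 < b by rewrite lt_def b_neq0.
(* Law of cosines: with [z1 = (1, 0)] and [z2 = (p, q)], this [p] gives [a * z1 + b * z2] length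
   [c]. *)
pose p : R := (c ^+ 2 - a ^+ 2 - b ^+ 2) / (2 * a * b).
have [q q2] : exists q : R, q ^+ 2 = 1 - p ^+ 2.
  exists (Num.sqrt (1 - p ^+ 2)); apply: sqr_sqrtr.
  (* Heron's factorization; each factor is nonnegative by the triangle inequalities. *)
  have -> : 1 - p ^+ 2 = (a + b + c) * (a + b - c) * (a + c - b) * (b + c - a)
      / (2 * a * b) ^+ 2 by rewrite /p; field; rewrite a_neq0 b_neq0.
  by rewrite divr_ge0 ?sqr_ge0 // !mulr_ge0 //; lra.
(* The third vector is [- (a * z1 + b * z2) / c], as the vanishing sum dictates. *)
exists (1, 0), (p, q), ((b ^+ 2 - a ^+ 2 - c ^+ 2) / (2 * a * c), - (b / c) * q).
split => /=; [split|..].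
- by ring.
- by rewrite q2; ring.
- by rewrite [(_ * q) ^+ 2]exprMn q2 /p; field; rewrite a_neq0 b_neq0 c_neq0.
- by rewrite /p; field; rewrite a_neq0 b_neq0 c_neq0.
- by field.
Qed.

(** Take the least [j] such that at least half of [A] has value at most [j]. Minimality bounds the
    part below, complementation the part above. *)
Lemma median_exists (T : finType) (A : {set T}) (f : T -> nat) : exists j,
  (2 * #|[set v in A | (f v < j)%N]| <= #|A|)%N /\
  (2 * #|[set v in A | (j < f v)%N]| <= #|A|)%N.
Proof.
have exj : exists j, (#|A| <= 2 * #|[set v in A | (f v <= j)%N]|)%N.
  exists (\max_v f v); rewrite (_ : [set v in A | _] = A) ?leq_pmull //.
  by apply/setP => v; rewrite inE leq_bigmax andbT.
case: (ex_minnP exj) => j Hj minj; exists j; split.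
  case: j Hj minj => [|j] _ minj.
    by rewrite (_ : [set v in A | _] = set0) ?cards0 //; apply/setP => v; rewrite !inE andbF.
  by apply: contraT; rewrite -ltnNge => /ltnW /minj; rewrite ltnn.
have := cardsID [set v | (f v <= j)%N] A.
have -> : A :&: [set v | (f v <= j)%N] = [set v in A | (f v <= j)%N].
  by apply/setP => v; rewrite !inE.
have -> : A :\: [set v | (f v <= j)%N] = [set v in A | (j < f v)%N].
  by apply/setP => v; rewrite !inE -ltnNge andbC.
by lia.
Qed.

Lemma separator_ge_of_balanced_coloring (R : rcfType) n (e : rel 'I_n) (s : seq R)
    (S : {set 'I_n}) (f : 'I_n -> nat) :
  simple_graph e -> is_sorted_spectrum (laplacian R e) s ->
  (forall u v, e u v -> u \notin S -> v \notin S -> f u = f v) ->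
  (forall c, (2 * #|[set v in ~: S | f v == c]| <= #|~: S|)%N) ->
  s`_1 * #|~: S|%:R <= (max_degree e)%:R * #|S|%:R.
Proof.
move=> eG specL fe f_le.
have [j [lo_le hi_le]] := median_exists (~: S) f; have mid_le := f_le j.
set lo := [set v in ~: S | (f v < j)%N] in lo_le.
set hi := [set v in ~: S | (j < f v)%N] in hi_le.
set mid := [set v in ~: S | f v == j] in mid_le.
have split_sum (F : 'I_n -> R) : (forall v, v \in S -> F v = 0) ->
    \sum_v F v = \sum_(v in lo) F v + \sum_(v in mid) F v + \sum_(v in hi) F v.
  move=> F0; rewrite (big_mkcond (mem lo)) (big_mkcond (mem mid)) (big_mkcond (mem hi)).
  rewrite -!big_split; apply: eq_bigr => v _ /=; rewrite !inE.
  case: (boolP (v \in S)) => [/F0 ->|_] /=; first by rewrite !addr0.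
  by case: ltngtP; rewrite ?addr0 ?add0r.
have cardE : #|~: S| = (#|lo| + #|mid| + #|hi|)%N.
  rewrite -!sum1_card (big_mkcond (mem (~: S))) (big_mkcond (mem lo)).
  rewrite (big_mkcond (mem mid)) (big_mkcond (mem hi)) -!big_split.
  by apply: eq_bigr => v _ /=; rewrite !inE; case: (v \in S) => //=; case: ltngtP.
(* None of the three parts exceeds half of the total, which is the triangle inequality for their
   sizes. *)
have [||||||z1 [z2 [z3 [[z1u z2u z3u] zx zy]]]] :=
  @unit_triangle R #|lo|%:R #|mid|%:R #|hi|%:R; rewrite -?natrD ?ler0n ?ler_nat //; try lia.
pose z v := if v \in S then (0, 0) else
  if (f v < j)%N then z1 else if (j < f v)%N then z3 else z2.
have zlo v : v \in lo -> z v = z1.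
  by rewrite /z !inE => /andP[/negPf -> ->].
have zmid v : v \in mid -> z v = z2.
  by rewrite /z !inE => /andP[/negPf -> /eqP ->]; rewrite ltnn.
have zhi v : v \in hi -> z v = z3.
  by rewrite /z !inE => /andP[/negPf -> fv]; rewrite fv ltnNge (ltnW fv).
have zS v : v \in S -> z v = (0, 0) by rewrite /z => ->.
have sum_const (B : {set 'I_n}) (c : R * R) (g : R * R -> R) :
    (forall v, v \in B -> z v = c) -> \sum_(v in B) g (z v) = #|B|%:R * g c.
  by move=> zB; rewrite mulr_natl -sumr_const; apply: eq_bigr => v /zB ->.
apply: (@separator_ge_of_plane_embedding R n e s S (fun v => (z v).1) (fun v => (z v).2)) => //.
- rewrite split_sum => [|v /zS -> //].
  by rewrite (sum_const lo z1 fst) ?(sum_const mid z2 fst) ?(sum_const hi z3 fst).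
- rewrite split_sum => [|v /zS -> //].
  by rewrite (sum_const lo z1 snd) ?(sum_const mid z2 snd) ?(sum_const hi z3 snd).
- move=> v; rewrite /z; case: (v \in S) => /=; first by rewrite expr0n addr0.
  by case: ltngtP.
- by move=> u v uv uS vS; rewrite /z (negPf uS) (negPf vS) (fe _ _ uv uS vS).
Qed.

(** * Rooted trees *)

Local Open Scope nat_scope.

(** Breadth-first search: [d v] is the length of a shortest walk from [v] to [r], and [p v] the
    second vertex of such a walk. *)
Lemma spanning_parent (T : finType) (t : rel T) (r : T) :
  (forall v, connect t v r) ->
  exists (d : T -> nat) (p : T -> T), forall v, v != r -> t v (p v) /\ d (p v) < d v.
Proof.
move=> t_conn.
pose walk v k := [exists s : k.-tuple T, path t v s && (last v s == r)].
have walkP v (s : seq T) : path t v s -> last v s = r -> walk v (size s).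
  by move=> vs sr; apply/existsP; exists (in_tuple s); rewrite vs sr eqxx.
have ex_walk v : exists k, walk v k.
  by case/connectP: (t_conn v) => s vs sr; exists (size s); apply: walkP.
pose d v := ex_minn (ex_walk v).
suff /fin_all_exists [p pP] : forall v, exists w, v != r -> t v w /\ d w < d v.
  by exists d, p.
move=> v; have [->|v_neq] := eqVneq v r; first by exists r.
rewrite {2}/d; case: ex_minnP => k /existsP[[s /= /eqP <-]] /andP[vs /eqP sr] _.
case: s vs sr => [|w s] /=; first by move=> _ vr; rewrite vr eqxx in v_neq.
move=> /andP[vw ws] sr; exists w => _; split=> //.
by rewrite /d; case: ex_minnP => j _ /(_ _ (walkP _ _ ws sr)).
Qed.

(** By counting: the [m] pairs [(v, p v)] and their [m] reversals are disjoint because [d] drops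
    along [p], so they exhaust the [2 * m] ordered edges. *)
Lemma tree_edges_are_parent_edges m (t : rel 'I_m.+1) (r : 'I_m.+1)
    (d : 'I_m.+1 -> nat) (p : 'I_m.+1 -> 'I_m.+1) :
  is_tree t -> (forall v, v != r -> t v (p v) /\ d (p v) < d v) ->
  forall a b, t a b -> (a != r /\ b = p a) \/ (b != r /\ a = p b).
Proof.
move=> [t_sym _ _ t_card] dp a b ab.
pose up := [set (v, p v) | v in [set~ r]]; pose down := [set (p v, v) | v in [set~ r]].
have card_up : #|up| = m.
  by rewrite card_imset ?cardsC1 ?card_ord // => x y [].
have card_down : #|down| = m.
  by rewrite card_imset ?cardsC1 ?card_ord // => x y [].
have disj : up :&: down = set0.
  apply/eqP; rewrite -subset0; apply/subsetP => _ /setIP[/imsetP[x xr ->]].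
  case/imsetP => y yr [xE yE]; move: xr yr; rewrite !inE => /dp[_] + /dp[_].
  by rewrite -xE yE; lia.
have : (a, b) \in up :|: down.
  rewrite (_ : up :|: down = [set q | t q.1 q.2]) ?inE //.
  apply/eqP; rewrite eqEcard t_card cardsU disj cards0 card_up card_down; apply/andP.
  split; last by lia.
  apply/subsetP => q /setUP[] /imsetP[v + ->]; rewrite !inE => /dp[vp _] //=.
  by rewrite t_sym.
by case/setUP => /imsetP[v]; rewrite !inE => vr [-> ->]; [left | right].
Qed.

(** Here [p] is the parent map and [D a] the set of descendants of [a], [a] included: the nodes
    whose chain of parents reaches [a]. *)
Lemma rooted_tree m (t : rel 'I_m.+1) : is_tree t ->
  exists (r : 'I_m.+1) (d : 'I_m.+1 -> nat) (p : 'I_m.+1 -> 'I_m.+1)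
         (D : 'I_m.+1 -> {set 'I_m.+1}),
  [/\ D r = setT /\ (forall a, a \in D a),
      forall a, a != r -> d (p a) < d a,
      forall a, a != r -> p a \notin D a,
      forall a x, x \in D a -> x != a -> exists c, [/\ c != r, p c = a & x \in D c]
    & forall a x y, t x y -> x \in D a -> y \notin D a -> [/\ a != r, x = a & y = p a]].
Proof.
move=> t_tree; have [t_sym t_irr t_conn _] := t_tree; pose r : 'I_m.+1 := ord0.
have [d [p dp]] := spanning_parent (fun v => t_conn v r).
have edgeP := tree_edges_are_parent_edges t_tree dp.
pose q := [rel x y | (x != r) && (y == p x)].
pose D a := [set x | connect q x a].
have Dp a x : x \in D a -> x != a -> x != r /\ p x \in D a.
  rewrite !inE => /connectP[[|y s] /= qs ->]; first by rewrite eqxx.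
  case/andP: qs => /andP[xr /eqP ->] ys _; split=> //.
  by apply/connectP; exists s.
have pD a x : x != r -> p x \in D a -> x \in D a.
  by rewrite !inE => xr; apply: connect_trans; rewrite connect1 //= xr eqxx.
(* Since [d] drops along parents, [a] minimizes [d] on [D a]; this is what keeps [p a] outside. *)
have D_le a x : x \in D a -> d a <= d x.
  have [k] := ubnP (d x); elim: k x => // k IHk x dx xD.
  have [->//|x_neq] := eqVneq x a; have [xr pxD] := Dp _ _ xD x_neq.
  by have [_ dpx] := dp _ xr; have := IHk (p x) _ pxD; lia.
exists r, d, p, D; split.
- split=> [|a]; last by rewrite inE connect0.
  apply/setP => x; rewrite [RHS]inE.
  have [k] := ubnP (d x); elim: k x => // k IHk x dx.
  have [->|xr] := eqVneq x r; first by rewrite inE connect0.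
  have [_ dpx] := dp _ xr.
  by apply: pD => //; apply: IHk; lia.
- by move=> a /dp[].
- by move=> a /dp[_ dpa]; apply/negP => /D_le; lia.
- move=> a x; have [k] := ubnP (d x); elim: k x => // k IHk x dx xD xa.
  have [xr pxD] := Dp _ _ xD xa; have [_ dpx] := dp _ xr.
  have [pxa|pxa] := eqVneq (p x) a; first by exists x; split=> //; rewrite inE connect0.
  have [|c [cr pc pxc]] := IHk (p x) _ pxD pxa; first by lia.
  by exists c; split=> //; apply: pD.
- move=> a x y xy xD yD; case: (edgeP _ _ xy) => -[nr E].
    have [xa|xa] := eqVneq x a; first by rewrite -xa.
    by have [_] := Dp _ _ xD xa; rewrite -E (negPf yD).
  by rewrite pD -?E // in yD.
Qed.

(** * Balanced separators from tree decompositions *)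

Lemma exists_subset_card (T : finType) (A : {set T}) k :
  k <= #|A| -> exists2 B : {set T}, B \subset A & #|B| = k.
Proof.
move=> kA; have : 0 < #|[set B : {set T} | B \subset A & #|B| == k]|.
  by rewrite cards_draws bin_gt0.
by case/card_gt0P => B; rewrite inE => /andP[BA /eqP Bk]; exists B.
Qed.

(* [P] and [Q] are the bags at the ends of a tree edge, [X] and [Y] the vertices
   on its two sides.  When both [P] and [Q] leave more than half on the far side,
   shrinking [P] (or [Q]) towards [X :&: Y] equalizes the two sides exactly. *)
Lemma balanced_separator_of_edge (T : finType) (X Y P Q : {set T}) :
  X :|: Y = setT -> P \subset X -> Q \subset Y ->
  X :&: Y \subset P :&: Q ->
  #|~: Q| < 2 * #|X :\: Q| -> #|~: P| < 2 * #|Y :\: P| ->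
  exists S : {set T}, [/\ X :&: Y \subset S, #|S| <= maxn #|P| #|Q|,
    2 * #|X :\: S| <= #|~: S| & 2 * #|Y :\: S| <= #|~: S|].
Proof.
wlog le_YX : X Y P Q / #|Y :\: X| <= #|X :\: Y| => [wl|].
  move=> XY PX QY XYPQ ltQ ltP.
  case: (leqP #|Y :\: X| #|X :\: Y|) => [le_YX|/ltnW le_XY]; first exact: wl le_YX _ _ _ _ _ _.
  have [||S [? ? ? ?]] := wl Y X Q P le_XY _ QY PX _ ltP ltQ.
  - by rewrite setUC.
  - by rewrite setIC [Q :&: P]setIC.
  - by exists S; split=> //; rewrite 1?setIC 1?maxnC.
move=> XY PX QY XYPQ _ ltP.
have cardC (A : {set T}) : X :&: Y \subset A -> 
    #|~: A| = #|X :\: A| + #|Y :\: A|.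
  move=> /subsetP IA; rewrite -cardsUI [X in _ + X](_ : _ = 0) ?addn0.
    by rewrite -setDUl XY setTD.
  apply/eqP; rewrite cards_eq0 -subset0; apply/subsetP => v; rewrite !inE.
  by case/andP => /andP[/negP vA vX] /andP[_ vY]; case: vA; apply: IA; rewrite inE vX.
have IP : X :&: Y \subset P by apply: subset_trans XYPQ (subsetIl _ _).
have YP : Y :\: P = Y :\: X.
  apply/setP => v; rewrite !inE; case: (boolP (v \in Y)) => vY; rewrite ?andbF // !andbT.
  congr (~~ _); apply/idP/idP => [/(subsetP PX) //|vX].
  by apply: (subsetP IP); rewrite inE vX.
have XP : #|X :\: Y| = #|X :\: P| + #|P :\: Y|.
  rewrite -(cardsID P (X :\: Y)) addnC; congr (_ + _); apply: eq_card => v.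
    rewrite !inE; case: (boolP (v \in P)) => //= vP; case: (boolP (v \in X)) => vX; rewrite ?andbF // ?andbT.
    by apply: contra vP => vY; apply: (subsetP IP); rewrite inE vX.
  by rewrite !inE; case: (boolP (v \in P)) => vP; rewrite ?andbF // (subsetP PX _ vP) !andbT.
(* [R] removes exactly the excess of [X] over [Y]. It fits in [P :\: Y] because [ltP] makes
   [X :\: P] smaller than [Y :\: X]. *)
have [|R RP cardR] := @exists_subset_card _ (P :\: Y) (#|X :\: Y| - #|Y :\: X|).
  by rewrite cardC // YP in ltP; lia.
exists (X :&: Y :|: R).
have RX : R \subset X :\: Y.
  by apply: subset_trans RP _; apply: setSD.
have YS : Y :\: (X :&: Y :|: R) = Y :\: X.
  apply/setP => v; rewrite !inE; have := subsetP RX v; rewrite !inE.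
  by case: (v \in Y) (v \in X) (v \in R) => [] [] [] //= /(_ isT).
have XS : X :\: (X :&: Y :|: R) = (X :\: Y) :\: R.
  apply/setP => v; rewrite !inE.
  by case: (v \in Y) (v \in X) (v \in R) => [] [] [].
have cardXS : #|X :\: (X :&: Y :|: R)| = #|Y :\: X|.
  by rewrite XS cardsDS // cardR subKn.
rewrite cardC ?subsetUl // YS cardXS; split=> //; [|lia|lia].
rewrite leq_max subset_leq_card // subUset IP /=.
by apply: subset_trans RP (subsetDl _ _).
Qed.

Lemma tree_decomposition_balanced_separator n (e : rel 'I_n) m (t : rel 'I_m.+1)
    (B : 'I_m.+1 -> {set 'I_n}) :
  is_tree_decomposition e t B ->
  exists (S : {set 'I_n}) (f : 'I_n -> nat),
  [/\ #|S| <= (td_width B).+1,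
      forall u v, e u v -> u \notin S -> v \notin S -> f u = f v
    & forall c, 2 * #|[set v in ~: S | f v == c]| <= #|~: S|].
Proof.
move=> [t_tree cover_v cover_e subtree].
have [t_sym _ _ _] := t_tree.
have [r [d [p [D [[Dr Daa] dp pD Dchild Dedge]]]]] := rooted_tree t_tree.
have bag_le i : #|B i| <= (td_width B).+1.
  by apply: leq_trans (leqSpred _); apply: (@leq_bigmax _ (fun i => #|B i|)).
pose U (A : {set 'I_m.+1}) := \bigcup_(i in A) B i.
(* A node is heavy if more than half of the vertices missing from its parent's
   bag lie below it.  The deepest heavy node has no heavy child, so either its
   bag separates evenly or the edge to its parent is heavy in both directions. *)
pose heavy a := (a == r) || (#|~: B (p a)| < 2 * #|U (D a) :\: B (p a)|).
have heavy_r : heavy r by rewrite /heavy eqxx.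
case: (arg_maxnP d heavy_r) => a heavy_a deepest_a.
have [/andP[ar up_heavy]|up_light] :=
  boolP ((a != r) && (#|~: B a| < 2 * #|U (~: D a) :\: B a|)).
  move: heavy_a; rewrite /heavy (negPf ar) /= => down_heavy.
  (* The nodes whose bags contain a vertex are connected, so if they meet both sides they include
     both ends of the only edge leaving [D a]. *)
  have crossing : U (D a) :&: U (~: D a) \subset B a :&: B (p a).
    apply/subsetP => v /setIP[/bigcupP[i iD vi] /bigcupP[j jD vj]].
    apply: contraTT jD => v_notin; rewrite inE negbK.
    rewrite -(closed_connect _ (subtree v i j vi vj)) // => x y /= /and3P[xy vx vy].
    apply/idP/idP => [xD|yD]; apply: contraNT v_notin => notinD.
      by have [_ <- <-] := Dedge _ _ _ xy xD notinD; rewrite inE vx.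
    by have [_ <- <-] := Dedge _ _ _ (etrans (t_sym _ _) xy) yD notinD; rewrite inE vy.
  have [|||S [IS S_le XS YS]] := balanced_separator_of_edge _ _ _ crossing down_heavy up_heavy.
  - apply/setP => v; rewrite [RHS]inE; have [i vi] := cover_v v; rewrite inE.
    by apply/orP; case: (boolP (i \in D a)) => iD; [left|right]; apply/bigcupP;
      exists i; rewrite // inE.
  - exact: bigcup_sup.
  - by apply: bigcup_sup; rewrite inE pD.
  (* The color records the side of the tree edge: outside [S] each vertex lies on exactly one side,
     and every graph edge sits inside one bag. *)
  exists S, (fun v => v \in U (D a) : nat); split.
  - by apply: leq_trans S_le _; rewrite geq_max !bag_le.
  - have notinS v : v \notin S -> v \in U (~: D a) -> v \in U (D a) = false.
      by move=> vS vY; apply: contraNF vS => vX; apply: (subsetP IS); rewrite inE vX.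
    move=> u v /cover_e[i /andP[ui vi]] uS vS; case: (boolP (i \in D a)) => iD.
      by rewrite !(subsetP (bigcup_sup i iD)).
    have iD' : i \in ~: D a by rewrite inE.
    by rewrite !notinS // (subsetP (bigcup_sup i iD')).
  - have covU v : v \notin U (D a) -> v \in U (~: D a).
      have [i vi] := cover_v v; move=> vX; apply/bigcupP; exists i => //.
      by rewrite inE; apply: contra vX => iD; apply/bigcupP; exists i.
    move=> c; case: c => [|[|c]].
    + apply: leq_trans YS; rewrite leq_mul2l /=; apply: subset_leq_card.
      apply/subsetP => v; rewrite !inE eqb0 => /andP[-> /covU ->] //.
    + apply: leq_trans XS; rewrite leq_mul2l /=; apply: subset_leq_card.
      by apply/subsetP => v; rewrite !inE eqb1.
    + rewrite (_ : [set v in _ | _] = set0) ?cards0 //.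
      by apply/setP => v; rewrite !inE; case: (v \in U (D a)); rewrite andbF.
have [idx idxP] := fin_all_exists cover_v.
(* Now [B a] itself separates. A vertex outside it has all its bags in one component of the tree
   minus [a]; the canonical root of that component is its color. *)
pose h := [rel x y | [&& t x y, x != a & y != a]].
have h_sym : connect_sym h.
  by apply: sym_connect_sym => x y /=; rewrite t_sym [(x != a) && _]andbC.
have h_conn v i j : v \notin B a -> v \in B i -> v \in B j -> connect h i j.
  move=> va vi vj; move: (subtree v i j vi vj).
  apply: connect_sub => x y /and3P[xy vx vy].
  apply: connect1; rewrite /= xy /=; apply/andP; split.
    by apply: contraNneq va => <-.
  by apply: contraNneq va => <-.
exists (B a), (fun v => val (fingraph.root h (idx v))); split; first exact: bag_le.
  move=> u v /cover_e[i /andP[ui vi]] ua va; congr val.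
  apply/(fingraph.rootP h_sym); apply: (@connect_trans _ _ i); first exact: (h_conn u).
  exact: (h_conn v).
move=> c; have [->|[v0]] := set_0Vmem [set v in ~: B a | val (fingraph.root h (idx v)) == c].
  by rewrite cards0.
rewrite !inE => /andP[v0a /eqP v0c].
(* It suffices to enclose the component of [v0] in a union of components carrying at most half of
   the vertices outside [B a]. *)
have class_le (X : {set 'I_m.+1}) : closed h X -> idx v0 \in X ->
    2 * #|U X :\: B a| <= #|~: B a| ->
    2 * #|[set v in ~: B a | val (fingraph.root h (idx v)) == c]| <= #|~: B a|.
  move=> X_closed v0X; apply: leq_trans; rewrite leq_mul2l /=.
  apply: subset_leq_card; apply/subsetP => v; rewrite !inE => /andP[-> /eqP vc].
  have /(fingraph.rootP h_sym) vv0 : fingraph.root h (idx v) = fingraph.root h (idx v0).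
    by apply: val_inj; rewrite /= vc v0c.
  by apply/bigcupP; exists (idx v); rewrite ?(closed_connect X_closed vv0).
(* Outside [D a], [up_light] gives the bound. Inside, the component lies below a child [b] of [a],
   which is not heavy since [a] is a deepest heavy node. *)
have [v0D|v0D] := boolP (idx v0 \in D a); last first.
  apply: (class_le (~: D a)); last first.
  - move: up_light; rewrite negb_and negbK -leqNgt => /orP[/eqP ar|//].
    by rewrite ar Dr inE in v0D.
  - by rewrite inE.
  apply: (intro_closed h_sym) => x y /and3P[xy xa ya]; rewrite !inE => xD.
  apply: contraNN xD => yD; apply: contraNT ya => xD.
  by have [_ -> _] := Dedge _ _ _ (etrans (t_sym _ _) xy) yD xD.
have [|b [br pb v0b]] := Dchild _ _ v0D.
  by apply: contraNneq v0a => <-.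
apply: (class_le (D b)) => //.
  apply: (intro_closed h_sym) => x y /and3P[xy xa ya] xD.
  apply: contraNT ya => yD; have [_ _ ->] := Dedge _ _ _ xy xD yD.
  by rewrite pb.
rewrite leqNgt; apply/negP => heavy_b.
have := deepest_a b; rewrite /heavy (negPf br) pb heavy_b => /(_ isT).
by have := dp b br; rewrite pb; lia.
Qed.

(* The treewidth bound *)
Local Close Scope nat_scope.

Theorem theorem1 (R : rcfType) (n : nat) (e : rel 'I_n) (s : seq R) :
  simple_graph e ->
  (1 <= max_degree e)%N ->
  is_sorted_spectrum (laplacian R e) s ->
  (treewidth e)%:R >=
    n%:R * s`_1 / ((max_degree e)%:R + s`_1) - 1.
Proof.
move=> eG Delta_ge1 specL.
rewrite /treewidth; case: ex_minnP => k /asboolP[m [t [B [td <-]]]] _.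
have [S [f [S_le f_edge f_bal]]] := tree_decomposition_balanced_separator td.
have S_ge := separator_ge_of_balanced_coloring eG specL f_edge f_bal.
have s1_ge0 := fiedler_ge0 1 eG specL.
have Delta_gt0 : 0 < (max_degree e)%:R :> R by rewrite ltr0n.
have nE : n%:R = #|S|%:R + #|~: S|%:R :> R by rewrite -natrD cardsC card_ord.
have {}S_le : #|S|%:R <= (td_width B)%:R + 1 :> R by rewrite natr1 ler_nat.
(* Splitting [n] as in [nE] and adding [s]_1 * #|S|[to both sides of]S_ge[bounds]n * s[_1] by [#|S|]
   times the denominator. *)
rewrite lerBlDr; apply: le_trans S_le; rewrite ler_pdivrMr; last by rewrite ltr_wpDr.
by rewrite nE mulrDl mulrDr addrC lerD // mulrC [#|S|%:R * _]mulrC.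
Qed.
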